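(* Let $[a,b]$ be a compact subinterval of $\mathbb{R}$ and let $f:[a,b]\to\mathbb{R}$ be a function. Let $A$ be the directed set of all pairs $(P,\delta)$, where $\delta$ is a gauge on $[a,b]$ and $P$ is a $\delta$-fine tagged partition of $[a,b]$, and let $I:A\to\mathbb{R}$ be the generalized sequence $I(\gamma)=S(P,f)$ for $\gamma=(P,\delta)\in A$. Then $f$ is Henstock integrable on $[a,b]$ if and only if the generalized sequence $\{I(\gamma)\}_{\gamma\in A}$ is convergent.
   Context: A gauge on $[a,b]$ is a function $\delta:[a,b]\to\mathbb{R}$ with $\delta(x)>0$ for all $x$. A tagged partition of $[a,b]$ is $P=\{x_0,\dots,x_n;c_1,\dots,c_n\}$ with $a=x_0<x_1<\dots<x_n=b$ and $c_i\in[x_{i-1},x_i]$ for each $i$. Its Riemann sum for $f$ is $S(P,f)=\sum_{i=1}^n f(c_i)(x_i-x_{i-1})$. The tagged partition $P$ is $\delta$-fine if $[x_{i-1},x_i]\subset(c_i-\delta(c_i),c_i+\delta(c_i))$ for each $i=1,\dots,n$. A function $f:[a,b]\to\mathbb{R}$ is Henstock integrable on $[a,b]$ if there is a real number $L$ such that for each $\epsilon>0$ there is a gauge $\delta$ on $[a,b]$ such that $|S(P,f)-L|<\epsilon$ for each $\delta$-fine tagged partition $P$ of $[a,b]$. A directed set is a non-empty set with a reflexive, transitive relation (''$e$ follows $c$'') such that any two elements $c,d$ have a common element $e$ following both. A generalized sequence (net) is a function defined on a directed set. The set $A$ is directed by: $(P,\delta)$ follows $(P_1,\delta_1)$ if $\delta(x)\le\delta_1(x)$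 for all $x\in[a,b]$ (no condition relating $P$ and $P_1$). A real-valued generalized sequence $\{I(\gamma)\}_{\gamma\in A}$ is convergent if there is a real number $L$ (its limit) such that for each $\epsilon>0$ there is $\gamma_0\in A$ with $|I(\gamma)-L|<\epsilon$ for every $\gamma\in A$ that follows $\gamma_0$. *)

(* Defs.v *)
From mathcomp Require Import all_boot all_order all_algebra.
From mathcomp Require Import boolp classical_sets reals set_interval numfun.
From mathcomp Require Import lra.

Set Implicit Arguments.
Unset Strict Implicit.
Unset Printing Implicit Defensive.

Import Order.TTheory GRing.Theory Num.Theory.
Local Open Scope classical_set_scope.
Local Open Scope ring_scope.

Definition itvcc (R : realType) (a b : R) : Type := {x : R | x \in `[a, b]}.

Record gauge_on (R : realType) (a b : R) := GaugeOn {
  gauge_fun :> itvcc a b -> R;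
  gauge_fun_gt0 : forall x, 0 < gauge_fun x }.

(* [nodes] lists x_1, ..., x_n only: [itv_partition a b] requires the sequence
   a :: nodes to be strictly increasing and to end at b. If a = b, the only
   possibility is n = 0. *)
Record tagged_partition (R : realType) (a b : R) := TaggedPartition {
  nodes : seq R;
  nodesP : itv_partition a b nodes;
  tags : 'I_(size nodes) -> itvcc a b;
  tagsP : forall i : 'I_(size nodes),
    nth b (a :: nodes) i <= val (tags i) <= nth b nodes i }.
Arguments tags {R a b} t i.
Arguments tagsP {R a b} t i.

(* For i : 'I_n the i-th subinterval is [lnode P i, rnode P i], that is
   [x_i, x_(i+1)]. *)
Definition lnode (R : realType) (a b : R) (P : tagged_partition a b)
  (i : 'I_(size (nodes P))) : R := nth b (a :: nodes P) i.

Definition rnode (R : realType) (a b : R) (P : tagged_partition a b)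
  (i : 'I_(size (nodes P))) : R := nth b (nodes P) i.

Arguments lnode {R a b} P i.
Arguments rnode {R a b} P i.

Definition riemann_sum (R : realType) (a b : R) (P : tagged_partition a b)
    (f : itvcc a b -> R) : R :=
  \sum_(i < size (nodes P)) f (tags P i) * (rnode P i - lnode P i).

Definition fine_partition (R : realType) (a b : R) (delta : gauge_on a b)
    (P : tagged_partition a b) : Prop :=
  forall i : 'I_(size (nodes P)),
    `[lnode P i, rnode P i] `<=`
    `]val (tags P i) - delta (tags P i), val (tags P i) + delta (tags P i)[.

Definition henstock_integrable (R : realType) (a b : R)
    (f : itvcc a b -> R) : Prop :=
  exists L : R, forall eps : R, 0 < eps ->
    exists delta : gauge_on a b, forall P : tagged_partition a b,
      fine_partition delta P -> `|riemann_sum P f - L| < eps.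

(* [follows e c] reads "e follows c". *)
Record directed_set := DirectedSet {
  dcarrier :> Type;
  follows : dcarrier -> dcarrier -> Prop;
  directed_nonempty : inhabited dcarrier;
  follows_refl : forall c, follows c c;
  follows_trans : forall e d c, follows e d -> follows d c -> follows e c;
  follows_directed : forall c d, exists e, follows e c /\ follows e d }.

Definition net_limit (R : realType) (D : directed_set) (u : D -> R) (L : R) :=
  forall eps : R, 0 < eps ->
    exists g0 : D, forall g : D, follows g g0 -> `|u g - L| < eps.

Definition net_convergent (R : realType) (D : directed_set) (u : D -> R) :=
  exists L : R, net_limit u L.

Definition fine_pair (R : realType) (a b : R) : Type :=
  {g : tagged_partition a b * gauge_on a b | fine_partition g.2 g.1}.

Definition fine_pair_follows (R : realType) (a b : R)
    (g g1 : fine_pair a b) : Prop :=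
  forall x : itvcc a b, (sval g).2 x <= (sval g1).2 x.

(* Cousin's lemma: every gauge admits a fine tagged partition. *)
Lemma cousin (R : realType) (a b : R) (hab : a <= b) (delta : gauge_on a b) :
  exists P : tagged_partition a b, fine_partition delta P.
Proof.
pose reach (x : R) := exists (s : seq R) (t : nat -> itvcc a b),
  itv_partition a x s /\
  forall i, (i < size s)%N ->
    [/\ nth b (a :: s) i <= val (t i) <= nth b s i,
        val (t i) - delta (t i) < nth b (a :: s) i &
        nth b s i < val (t i) + delta (t i)].
have step x y (c : itvcc a b) : reach x -> x < y -> x <= val c <= y ->
    val c - delta c < x -> y < val c + delta c -> reach y.
  move=> [s [t [[sp /eqP sl] st]]] xy xcy cx yc.
  exists (rcons s y), (fun i => if (i < size s)%N then t i else c); split.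
    by split; rewrite ?rcons_path ?sp ?sl ?xy// last_rcons.
  move=> i; rewrite size_rcons ltnS -rcons_cons !nth_rcons /= leq_eqVlt.
  case/orP=> [/eqP->|is_].
    by rewrite ltnSn ltnn eqxx -last_nth sl.
  by rewrite is_ ltnS (ltnW is_); exact: st.
have reacha : reach a.
  have aab : a \in `[a, b] by rewrite in_itv /= lexx.
  exists [::], (fun=> exist _ a aab); split; last by [].
  by rewrite /itv_partition /= eqxx.
pose E : set R := [set x | a <= x <= b /\ reach x].
have Ea : E a by split=> //; rewrite lexx.
have Eb : ubound E b by move=> x [/andP[]].
have hsE : has_sup E by split; [exists a | exists b].
have as_ : a <= sup E by apply: ub_le_sup => //; exists b.
have sb : sup E <= b by apply: ge_sup => //; exists a.
have sI : sup E \in `[a, b] by rewrite in_itv /= as_.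
pose c : itvcc a b := exist _ (sup E) sI.
have d0 := gauge_fun_gt0 delta c.
have reachs : reach (sup E).
  have [x [xab rx] sx] := sup_adherent d0 hsE.
  have : x <= sup E by apply: ub_le_sup => //; exists b.
  rewrite le_eqVlt => /orP[/eqP<-//|xs].
  by apply: (step x _ c) => //=; rewrite ?lexx ?(ltW xs)// ltrDl.
have reachb : reach b.
  move: sb; rewrite le_eqVlt => /orP[/eqP<-//|sltb].
  pose y := Num.min b (sup E + delta c / 2).
  have sy : sup E < y by rewrite lt_min sltb /=; lra.
  have yd : y < sup E + delta c.
    by rewrite gt_min; apply/orP; right; lra.
  have yb : y <= b by rewrite ge_min lexx.
  have ry : reach y.
    by apply: (step (sup E) _ c) => //=; rewrite ?lexx ?(ltW sy)//; lra.
  have : y <= sup E.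
    apply: ub_le_sup; first by exists b.
    by split=> //; rewrite yb andbT; lra.
  by rewrite leNgt sy.
have [s [t [sp st]]] := reachb.
have tP (i : 'I_(size s)) : nth b (a :: s) i <= val (t i) <= nth b s i.
  by have [] := st _ (ltn_ord i).
exists (TaggedPartition sp (tags := fun i => t (val i)) tP) => i z /=.
rewrite /lnode /rnode /= !in_itv /= => /andP[lz zr].
have [_ lo hi] := st _ (ltn_ord i).
by rewrite (lt_le_trans lo lz) (le_lt_trans zr hi).
Qed.

Definition unit_gauge (R : realType) (a b : R) : gauge_on a b :=
  @GaugeOn R a b (fun=> 1) (fun=> ltr01).

Lemma min_gauge_gt0 (R : realType) (a b : R) (d e : gauge_on a b)
  (x : itvcc a b) : 0 < Num.min (d x) (e x).
Proof. by rewrite lt_min !gauge_fun_gt0. Qed.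

Lemma fine_pair_nonempty (R : realType) (a b : R) (hab : a <= b) :
  inhabited (fine_pair a b).
Proof.
have [P fP] := cousin hab (unit_gauge a b).
exact: inhabits (exist (fun g => fine_partition g.2 g.1) (P, _) fP).
Qed.

Lemma fine_pair_follows_refl (R : realType) (a b : R) (g : fine_pair a b) :
  fine_pair_follows g g.
Proof. by move=> x. Qed.

Lemma fine_pair_follows_trans (R : realType) (a b : R)
    (g3 g2 g1 : fine_pair a b) :
  fine_pair_follows g3 g2 -> fine_pair_follows g2 g1 ->
  fine_pair_follows g3 g1.
Proof. by move=> h32 h21 x; exact: le_trans (h32 x) (h21 x). Qed.

Lemma fine_pair_follows_directed (R : realType) (a b : R) (hab : a <= b)
    (g1 g2 : fine_pair a b) :
  exists g, fine_pair_follows g g1 /\ fine_pair_follows g g2.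
Proof.
have [P fP] := cousin hab (GaugeOn (min_gauge_gt0 (sval g1).2 (sval g2).2)).
exists (exist (fun g => fine_partition g.2 g.1) (P, _) fP).
by split=> x /=; rewrite ge_min lexx ?orbT.
Qed.

Definition fine_pair_directed (R : realType) (a b : R) (hab : a <= b) :
    directed_set :=
  DirectedSet (fine_pair_nonempty hab) (@fine_pair_follows_refl R a b)
    (@fine_pair_follows_trans R a b) (fine_pair_follows_directed hab).

Definition riemann_net (R : realType) (a b : R) (hab : a <= b)
    (f : itvcc a b -> R) (g : fine_pair_directed hab) : R :=
  riemann_sum (sval g).1 f.
Arguments riemann_net {R a b} hab f g.

(* Main.v *)
(** Shrinking a gauge leaves fewer fine partitions, so being far along the net
    means exactly being fine for a given gauge: a gauge that witnesses Henstock
    integrability becomes an index of the net once Cousin's lemma supplies a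
    fine partition, and conversely the gauge of any index (P0, delta0) serves
    as a witness, since every delta0-fine P gives a pair (P, delta0) following
    (P0, delta0). *)
Require Import Defs.
From mathcomp Require Import all_boot all_order all_algebra.
From mathcomp Require Import reals.

Import Order.TTheory GRing.Theory Num.Theory.
Local Open Scope ring_scope.

(** The tags stay fixed, so a larger gauge only widens the open interval around each tag. *)
Lemma fine_partition_le (R : realType) (a b : R) (d e : gauge_on a b)
    (P : tagged_partition a b) :
  (forall x, d x <= e x) -> fine_partition d P -> fine_partition e P.
Proof.
move=> de dP i x /dP; rewrite /= !in_itv /= => /andP[lx xr].
by rewrite (le_lt_trans _ lx) ?(lt_le_trans xr) ?lerD2l ?lerN2.
Qed.

Theorem theorem1 (R : realType) (a b : R) (hab : a <= b)
    (f : itvcc a b -> R) :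
  henstock_integrable f <-> net_convergent (riemann_net hab f).
Proof.
(* The same [L] serves in both directions: the integral is the limit of the net. *)
split=> -[L fL]; exists L => eps /fL.
- move=> [delta deltaL]; have [P0 P0_fine] := cousin hab delta.
  exists (exist (fun g => fine_partition g.2 g.1) (P0, delta) P0_fine).
  move=> [[P e] P_fine] le_e_delta.
  exact: deltaL (fine_partition_le _ _ _ _ _ _ le_e_delta P_fine).
- move=> [[[P0 delta0] P0_fine] netL]; exists delta0 => P P_fine.
  apply: (netL (exist (fun g => fine_partition g.2 g.1) (P, delta0) P_fine)).
  (* The indices [(P, delta0)] and [(P0, delta0)] may differ, but the relation compares gauges only,
     so it unfolds here to [delta0 x <= delta0 x]. *)
  exact: fine_pair_follows_refl.
Qed.
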